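(* Let $J$ be the symmetric Jacobi matrix corresponding to a positive-definite linear functional $\mathcal{L}$ normalized by $\mathcal{L}(1)=1$. If $J$ is a bounded operator on $\ell^2$, then for any $\kappa\in\mathbb{C}\setminus\mathbb{R}$ $$\sigma(J)=\sigma(J_C(\kappa)),$$ where $J_C(\kappa)$ is the (symmetrized) Christoffel transformation of $J$ at $\kappa$ and $\sigma$ denotes the spectrum of the operator on $\ell^2$.
   Context: A linear functional $\mathcal{L}:\mathbb{C}[z]\to\mathbb{C}$ is positive-definite if $\mathcal{L}[p]>0$ for every polynomial $p$ that is not identically zero and is non-negative on $\mathbb{R}$. Its monic orthogonal polynomials $P_n$ ($\deg P_n=n$, $\mathcal{L}[P_nP_m]=0$ for $n\neq m$) satisfy $P_0=1$, $P_1(z)=z-c_1$, $zP_n=P_{n+1}+c_{n+1}P_n+\lambda_{n+1}P_{n-1}$ for $n\ge1$, with $c_n\in\mathbb{R}$, $\lambda_n>0$, and have only real zeros. The symmetric Jacobi matrix $J$ corresponding to $\mathcal{L}$ is the semi-infinite symmetric tridiagonal matrix with diagonal $b_j=c_{j+1}$ and off-diagonal entries $a_j=\sqrt{\lambda_{j+2}}$, $j\ge0$. It generates a closed operator on $\ell^2$, bounded iff $a_j,b_j$ are bounded. For $\kappa\in\mathbb{C}\setminus\mathbb{R}$ set $d_j=-P_{j+1}(\kappa)/P_j(\kappa)$ and $v_j=a_j/d_j$, $j\ge0$, and let $L$ be the lower bidiagonal semi-infinite matrix with diagonal entries $\sqrt{d_0},\sqrt{d_1},\dots$ and subdiagonal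 entries $v_0\sqrt{d_0},v_1\sqrt{d_1},\dots$ (either value of each complex square root may be taken). Then $J-\kappa I=LL^\top$ (here $\top$ is the transpose without complex conjugation) and $J_C(\kappa)=L^\top L+\kappa I$. *)

(* Defs.v *)
From HB Require Import structures.
From mathcomp Require Import all_boot all_order all_algebra.
From mathcomp Require Import all_classical all_reals all_analysis.
From mathcomp Require Export complex.
Set Implicit Arguments.
Unset Strict Implicit.
Unset Printing Implicit Defensive.
Import Order.TTheory GRing.Theory Num.Theory.
Import numFieldNormedType.Exports.

Local Open Scope classical_set_scope.
Local Open Scope ring_scope.
Local Open Scope complex_scope.

Section Functional.
Variable R : realType.
Implicit Types (Lf : {scalar {poly R[i]}}) (P : nat -> {poly R[i]}).

(* The order on R[i] is the partial one: 0 <= z means Im z = 0 and 0 <= Re z. *)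
Definition positive_definite Lf : Prop :=
  forall p : {poly R[i]}, p != 0 -> (forall x : R, 0 <= p.[x%:C]) -> 0 < Lf p.

Definition monic_orthogonal Lf P : Prop :=
  [/\ forall n, P n \is monic,
      forall n, size (P n) = n.+1
    & forall n m, n != m -> Lf (P n * P m) = 0].

(* c 0, lam 0 and lam 1 are junk values that are never used. *)
Definition recurrence_coefficients P (c lam : nat -> R) : Prop :=
  [/\ P 0 = 1,
      P 1 = 'X - (c 1)%:C%:P
    & forall n, (0 < n)%N ->
        'X * P n = P n.+1 + (c n.+1)%:C *: P n + (lam n.+1)%:C *: P n.-1].

End Functional.

Section SemiInfinite.
Variable R : realType.

Definition simx := nat -> nat -> R[i].
Implicit Types (A B : simx) (u : nat -> R[i]) (z : R[i]).

(* These two products are the usual ones when A i k = 0 for k > i + 1, since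
   the sum over k is then finite.  They are only applied to such A: tridiagonal,
   lower bidiagonal or upper bidiagonal. *)
Definition simx_mul A B : simx :=
  fun i j => \sum_(k < i.+2) A i k * B k j.
Definition simx_app A u : nat -> R[i] :=
  fun i => \sum_(k < i.+2) A i k * u k.

Definition simx_tr A : simx := fun i j => A j i.
Definition simx_add A B : simx := fun i j => A i j + B i j.
Definition simx_scalar z : simx := fun i j => if i == j then z else 0.

Definition l2 : set (nat -> R[i]) :=
  [set u | cvgn (series (fun n => Normc.normc (u n) ^+ 2))].
Definition l2norm u : R :=
  Num.sqrt (limn (series (fun n => Normc.normc (u n) ^+ 2))).

(* A acts on l2 as a (closed) operator with its maximal domain.  For a bounded
   operator the domain is the whole of l2; a bounded Jacobi matrix has a bounded
   Christoffel transformation, so there the choice of domain is immaterial. *)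
Definition dom A : set (nat -> R[i]) :=
  [set u | l2 u /\ l2 (simx_app A u)].

Definition bounded_operator A : Prop :=
  dom A = l2 /\
  exists M : R, forall u, l2 u -> l2norm (simx_app A u) <= M * l2norm u.

Definition resolvent_set A : set R[i] :=
  [set z | let Az := simx_add A (simx_scalar (- z)) in
     set_bij (dom Az) l2 (simx_app Az) /\
     exists M : R, forall u, dom Az u ->
       l2norm u <= M * l2norm (simx_app Az u)].

Definition spectrum A : set R[i] := ~` resolvent_set A.

End SemiInfinite.

Section Jacobi.
Variable R : realType.
Variables (P : nat -> {poly R[i]}) (c lam : nat -> R).

Definition jacobi_diag (j : nat) : R := c j.+1.
Definition jacobi_off (j : nat) : R := Num.sqrt (lam j.+2).

Definition jacobi : simx R := fun i j =>
  if i == j then (jacobi_diag i)%:C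
  else if j == i.+1 then (jacobi_off i)%:C
  else if i == j.+1 then (jacobi_off j)%:C
  else 0.

Variable kappa : R[i].

Definition christoffel_d (j : nat) : R[i] :=
  - ((P j.+1).[kappa] / (P j).[kappa]).
Definition christoffel_v (j : nat) : R[i] :=
  (jacobi_off j)%:C / christoffel_d j.

(* s j stands for a chosen value of the square root of d_j. *)
Variable s : nat -> R[i].

Definition is_sqrt_choice : Prop := forall j, s j ^+ 2 = christoffel_d j.

Definition christoffel_L : simx R := fun i j =>
  if i == j then s j
  else if i == j.+1 then christoffel_v j * s j
  else 0.

Definition christoffel : simx R :=
  simx_add (simx_mul (simx_tr christoffel_L) christoffel_L)
           (simx_scalar kappa).

End Jacobi.

(* Main.v *)
Require Import Defs.
From mathcomp Require Import all_boot all_order all_algebra.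
From mathcomp Require Import all_classical all_reals all_analysis.
From mathcomp Require Import ring lra zify.
Set Implicit Arguments.
Unset Strict Implicit.
Unset Printing Implicit Defensive.
Import Order.TTheory GRing.Theory Num.Theory.
Import numFieldNormedType.Exports.
Local Open Scope ring_scope.
Local Open Scope complex_scope.
Import Normc.

(** Writing [L] for the lower bidiagonal factor, [J - kappa = L L^T] and
    [J_C - kappa = L^T L] give [J L = L J_C], as an identity of operators on all
    sequences.  So it suffices that [L] is a bijection of l2, bounded in both
    directions: then [J] and [J_C] are similar.

    - [d_(j+1) = b_(j+1) - kappa - a_j^2 / d_j] shows that [Im d_j] has the sign
      of [- Im kappa] and [|d_j| >= |Im kappa|]; hence the entries of [L], whose
      squares are [d_j] and [a_j^2 / d_j], are bounded, and so is [L].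
    - For [u] given and [N] fixed, pick [x] supported on the first [N] indices
      with [L^T x = u] there.  As [L] is lower triangular, [(J - kappa) x = L u]
      there as well, and [Im <x, (J - kappa) x> = - Im kappa |x|^2] yields
      [|u|_N <= C |x| <= C / |Im kappa| |L u|_N], uniformly in [N]. *)

(** * Square-summable sequences through their truncated norms *)

Section Sequences.
Variable R : realType.
Implicit Types (u v w x p q : nat -> R[i]).

(** The squared modulus as a polynomial in the real and imaginary parts, so that estimates become
    real polynomial arithmetic without square roots. *)
Definition normsq (z : R[i]) : R := complex.Re z ^+ 2 + complex.Im z ^+ 2.

Lemma normc_sqr (z : R[i]) : normc z ^+ 2 = normsq z.
Proof. by case: z => a b; rewrite sqr_sqrtr // addr_ge0 ?sqr_ge0. Qed.

Lemma normsq_ge0 z : 0 <= normsq z.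
Proof. by rewrite addr_ge0 ?sqr_ge0. Qed.

Lemma normsqM z t : normsq (z * t) = normsq z * normsq t.
Proof. by case: z t => a b [a' b']; rewrite /normsq /=; ring. Qed.

Lemma normsqD_le z t : normsq (z + t) <= 2 * (normsq z + normsq t).
Proof.
case: z t => a b [a' b']; rewrite /normsq /= -subr_ge0.
have -> : 2 * (a ^+ 2 + b ^+ 2 + (a' ^+ 2 + b' ^+ 2)) -
   ((a + a') ^+ 2 + (b + b') ^+ 2) = (a - a') ^+ 2 + (b - b') ^+ 2 by ring.
by rewrite addr_ge0 ?sqr_ge0.
Qed.

Lemma normsqV z : normsq z^-1 = (normsq z)^-1.
Proof. by rewrite -!normc_sqr normcV exprVn. Qed.

Lemma normsq0 : normsq 0 = 0.
Proof. by rewrite /normsq /= expr0n addr0. Qed.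

Definition partial_normsq u : nat -> R :=
  series (fun n => normc (u n) ^+ 2).

Lemma partial_normsq0 u : partial_normsq u 0 = 0.
Proof. by rewrite /partial_normsq /series /= big_geq. Qed.

Lemma partial_normsqS u N :
  partial_normsq u N.+1 = partial_normsq u N + normsq (u N).
Proof. by rewrite /partial_normsq /series /= big_nat_recr //= normc_sqr. Qed.

Lemma partial_normsq_nd u : nondecreasing_seq (partial_normsq u).
Proof.
by apply/nondecreasing_seqP => n; rewrite partial_normsqS lerDl normsq_ge0.
Qed.

Lemma partial_normsq_ge0 u N : 0 <= partial_normsq u N.
Proof. by rewrite -(partial_normsq0 u); apply: partial_normsq_nd. Qed.

Lemma l2norm_ge0 u : 0 <= l2norm u.
Proof. exact: sqrtr_ge0. Qed.

Lemma partial_normsq_le_l2norm u N : l2 u ->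
  partial_normsq u N <= l2norm u ^+ 2.
Proof.
move=> hu; have le n := nondecreasing_cvgn_le (partial_normsq_nd u) hu n.
by rewrite sqr_sqrtr //; apply: le_trans (le 0%N); rewrite partial_normsq_ge0.
Qed.

Lemma l2_bounded u (B : R) : 0 <= B ->
  (forall N, partial_normsq u N <= B ^+ 2) -> l2 u /\ l2norm u <= B.
Proof.
move=> B0 hB.
have hu : l2 u.
  apply: nondecreasing_is_cvgn; first exact: partial_normsq_nd.
  by exists (B ^+ 2) => _ [n _ <-]; apply: hB.
split=> //; rewrite -(ler_pXn2r (n := 2)) ?nnegrE ?l2norm_ge0 //.
rewrite sqr_sqrtr; last first.
  by apply: limr_ge => //; apply: nearW => n; apply: partial_normsq_ge0.
by apply: limr_le => //; apply: nearW => n; apply: hB.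
Qed.

(** Partial sums of squares are monotone, so a bound uniform in [N] gives both membership in l2 and
    the norm inequality. All estimates on [L] are therefore made on truncations. *)
Lemma l2_dominated u v (K : R) : 0 <= K ->
  (forall N, partial_normsq v N <= K ^+ 2 * partial_normsq u N) ->
  l2 u -> l2 v /\ l2norm v <= K * l2norm u.
Proof.
move=> K0 huv hu; apply: l2_bounded => [|N].
  by rewrite mulr_ge0 ?l2norm_ge0.
rewrite exprMn; apply: le_trans (huv N) _.
by rewrite ler_wpM2l ?sqr_ge0 ?partial_normsq_le_l2norm.
Qed.

Lemma normsq_le_l2norm u i : l2 u -> normsq (u i) <= l2norm u ^+ 2.
Proof.
move=> /(partial_normsq_le_l2norm i.+1); apply: le_trans.
by rewrite partial_normsqS lerDr partial_normsq_ge0.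
Qed.

(** * Bidiagonal operators and their transposes *)

Definition lower_app p q u : nat -> R[i] :=
  fun i => p i * u i + (if i is j.+1 then q j * u j else 0).
Definition upper_app p q u : nat -> R[i] :=
  fun i => p i * u i + q i * u i.+1.

(** Forward substitution. It inverts [lower_app p q] on arbitrary sequences; summability is treated
    separately. *)
Fixpoint lower_solve p q w (i : nat) : R[i] :=
  if i is j.+1 then (w i - q j * lower_solve p q w j) / p i
  else w 0%N / p 0%N.

Lemma lower_solveK p q w : (forall j, p j != 0) ->
  lower_app p q (lower_solve p q w) = w.
Proof.
move=> p0; apply/funext => -[|j]; rewrite /lower_app /=; last first.
  by rewrite [p _ * _]mulrC divfK // subrK.
by rewrite addr0 mulrC divfK.
Qed.

Lemma lower_appK p q u : (forall j, p j != 0) ->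
  lower_solve p q (lower_app p q u) = u.
Proof.
move=> p0; apply/funext; elim=> [|j IH] /=.
  by rewrite /lower_app addr0 mulrC mulKf.
by rewrite IH /lower_app addrK mulrC mulKf.
Qed.

(** Back substitution: setting [x] to zero from [N] on closes the system. The induction shifts all
    sequences by one, so row 0 is solved last. *)
Lemma upper_section_surj p q u N : (forall j, p j != 0) ->
  exists2 x, forall j, (N <= j)%N -> x j = 0
    & forall j, (j < N)%N -> upper_app p q x j = u j.
Proof.
elim: N p q u => [|N IH] p q u p0; first by exists (fun=> 0).
have [//|x x0 hx] := IH (p \o S) (q \o S) (u \o S).
  by move=> j; apply: p0.
exists (fun j => if j is k.+1 then x k else (u 0 - q 0 * x 0) / p 0)%N.
  by case.
case=> [_|j /hx //].
by rewrite /upper_app mulrC divfK // subrK.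
Qed.

Lemma partial_normsq_lower p q u (D : R) N :
  (forall j, normsq (p j) <= D) -> (forall j, normsq (q j) <= D) ->
  partial_normsq (lower_app p q u) N <= 4 * D * partial_normsq u N.
Proof.
move=> hp hq.
have D0 : 0 <= D by apply: le_trans (hp 0%N); apply: normsq_ge0.
have step c i : normsq c <= D -> normsq (c * u i) <= D * normsq (u i).
  by move=> ?; rewrite normsqM ler_wpM2r ?normsq_ge0.
(* The first [N] rows see [N] diagonal terms but only [N - 1] subdiagonal ones; keeping the two sums
   apart lets the induction close. *)
suff : partial_normsq (lower_app p q u) N <= 2 * D *
  (partial_normsq u N + (if N is n.+1 then partial_normsq u n else 0)).
  move=> /le_trans; apply; case: N => [|n].
    by rewrite partial_normsq0 addr0 !mulr0.
  have := ler_wpM2l D0 (partial_normsq_nd u (leqnSn n)); nra.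
elim: N => [|N IH]; first by rewrite !partial_normsq0 addr0 mulr0.
rewrite [X in X <= _]partial_normsqS [X in _ * (X + _)]partial_normsqS.
apply: le_trans (lerD IH (normsqD_le _ _)) _.
have := step _ N (hp N); case: N {IH} => [|N] h1.
  by rewrite normsq0 partial_normsq0; lra.
by have := step _ N (hq N); rewrite !partial_normsqS; nra.
Qed.

(** Row [N - 1] reads [x N], hence the truncation at [N.+1] on the right. *)
Lemma partial_normsq_upper p q x (D : R) N :
  (forall j, normsq (p j) <= D) -> (forall j, normsq (q j) <= D) ->
  partial_normsq (upper_app p q x) N <= 4 * D * partial_normsq x N.+1.
Proof.
move=> hp hq.
have D0 : 0 <= D by apply: le_trans (hp 0%N); apply: normsq_ge0.
have step c i : normsq c <= D -> normsq (c * x i) <= D * normsq (x i).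
  by move=> ?; rewrite normsqM ler_wpM2r ?normsq_ge0.
suff : partial_normsq (upper_app p q x) N <= 2 * D *
  (partial_normsq x N + partial_normsq x N.+1).
  move=> /le_trans; apply; rewrite partial_normsqS.
  have := mulr_ge0 D0 (normsq_ge0 (x N)).
  nra.
elim: N => [|N IH].
  by rewrite partial_normsqS !partial_normsq0 !add0r !mulr_ge0 ?normsq_ge0.
rewrite [X in X <= _]partial_normsqS.
apply: le_trans (lerD IH (normsqD_le _ _)) _.
have := step _ N (hp N); have := step _ N.+1 (hq N).
by rewrite !partial_normsqS; nra.
Qed.

(** * Two-sided bounds for the factor [L] *)

Section BidiagonalFactor.
Variables (p q : nat -> R[i]) (y D : R).
Hypothesis p_neq0 : forall j, p j != 0.
Hypothesis p_le : forall j, normsq (p j) <= D.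
Hypothesis q_le : forall j, normsq (q j) <= D.
(** The three hypotheses on imaginary parts concern the entries of [L L^T]: it is a real symmetric
    tridiagonal matrix minus [i y], as [J - kappa] is with [y = Im kappa]. *)
Hypothesis Im_diag0 : complex.Im (p 0%N ^+ 2) = - y.
Hypothesis Im_diagS : forall j, complex.Im (p j.+1 ^+ 2 + q j ^+ 2) = - y.
Hypothesis Im_off : forall j, complex.Im (p j * q j) = 0.

Local Notation lower := (lower_app p q).
Local Notation upper := (upper_app p q).

(** The real symmetric off-diagonal entries contribute conjugate pairs, whose imaginary parts
    cancel. Only the pair cut by the truncation, coupling [x (N-1)] to [x N], survives. *)
Lemma Im_quadratic_form x N :
  \sum_(i < N) complex.Im ((x i)^* * lower (upper x) i) =
  - y * partial_normsq x N +
  (if N is n.+1 then complex.Im ((x n)^* * (p n * q n * x N)) else 0).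
Proof.
elim: N => [|N IH]; first by rewrite big_ord0 partial_normsq0 mulr0 addr0.
rewrite big_ord_recr /= IH partial_normsqS (mulrDr (- y)) -!addrA.
congr (_ + _).
case: N {IH} => [|N] /=.
  have -> : lower (upper x) 0%N = p 0%N ^+ 2 * x 0%N + p 0%N * q 0%N * x 1%N.
    by rewrite /lower_app /upper_app; ring.
  rewrite add0r.
  move: Im_diag0 (Im_off 0).
  case: (p 0%N ^+ 2) (p 0%N * q 0%N) (x 0%N) (x 1%N) => [? ?] [? ?] [? ?] [? ?].
  by rewrite /normsq /= => -> ->; ring.
have -> : lower (upper x) N.+1 = (p N.+1 ^+ 2 + q N ^+ 2) * x N.+1 +
    p N.+1 * q N.+1 * x N.+2 + p N * q N * x N.
  by rewrite /lower_app /upper_app; ring.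
move: (Im_diagS N) (Im_off N) (Im_off N.+1).
case: (p N.+1 ^+ 2 + _) (p N * _) (p N.+1 * _) (x N) (x N.+1) (x N.+2) =>
  [? ?] [? ?] [? ?] [? ?] [? ?] [? ?].
by rewrite /normsq /= => -> -> ->; ring.
Qed.

Lemma upper_section_bound x w N : x N = 0 ->
  (forall i, (i < N)%N -> lower (upper x) i = w i) ->
  y ^+ 2 * partial_normsq x N <= partial_normsq w N.
Proof.
move=> xN hw.
have : y * (y * partial_normsq x N) =
    - \sum_(i < N) y * complex.Im ((x i)^* * w i).
  rewrite -mulr_sumr -mulrN; congr (_ * _).
  rewrite -[y * _]opprK -mulNr; congr (- _).
  under eq_bigr => i _ do rewrite -hw //.
  rewrite Im_quadratic_form.
  by case: N xN {hw} => [|n] xN; rewrite ?xN ?mulr0 addr0.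
(* Each summand is [|y x_i - i w_i|^2]; expanding this square replaces Cauchy-Schwarz. *)
have : 0 <= \sum_(i < N) (y ^+ 2 * normsq (x i) + normsq (w i) +
    2 * (y * complex.Im ((x i)^* * w i))).
  apply: sumr_ge0 => i _; case: (x i) (w i) => [a b] [a' b'].
  rewrite /normsq /=.
  have -> : y ^+ 2 * (a ^+ 2 + b ^+ 2) + (a' ^+ 2 + b' ^+ 2) +
      2 * (y * (a * b' + - b * a')) = (y * a + b') ^+ 2 + (y * b - a') ^+ 2.
    by ring.
  by rewrite addr_ge0 ?sqr_ge0.
rewrite 2!big_split /= -!mulr_sumr.
have sumE (z : nat -> R[i]) : \sum_(i < N) normsq (z i) = partial_normsq z N.
  rewrite /partial_normsq /series /= big_mkord.
  by apply: eq_bigr => i _; rewrite normc_sqr.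
rewrite !sumE expr2 -!mulrA; set S := \sum_(i < N) _.
by move=> ? ?; lra.
Qed.

Hypothesis y_neq0 : y != 0.

(* The leading section of [L] is the lower bidiagonal matrix of the leading
   section of [u], so [u = L^T x] can be solved on the section with [x]
   supported there, and [L L^T x = L u] on the section. *)
Lemma partial_normsq_lower_ge u N :
  partial_normsq u N <= 4 * D / y ^+ 2 * partial_normsq (lower u) N.
Proof.
have D0 : 0 <= D by apply: le_trans (p_le 0); apply: normsq_ge0.
have [x x0 hx] := upper_section_surj q u N p_neq0.
have -> : partial_normsq u N = partial_normsq (upper x) N.
  rewrite /partial_normsq /series /=; apply: eq_big_nat => i /andP[_ iN].
  by rewrite hx.
apply: le_trans (partial_normsq_upper x N p_le q_le) _.
rewrite partial_normsqS x0 // normsq0 addr0 -[4 * D / _ * _]mulrA.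
rewrite ler_wpM2l ?mulr_ge0 // mulrC ler_pdivlMr ?exprn_even_gt0 // mulrC.
apply: upper_section_bound => [|i iN]; first exact: x0.
rewrite /lower_app hx //; case: i iN => // i /ltnW iN.
by rewrite hx.
Qed.

Lemma lower_l2 u : l2 u ->
  l2 (lower u) /\ l2norm (lower u) <= Num.sqrt (4 * D) * l2norm u.
Proof.
have D0 : 0 <= D by apply: le_trans (p_le 0); apply: normsq_ge0.
apply: l2_dominated => [|N]; first exact: sqrtr_ge0.
by rewrite sqr_sqrtr ?mulr_ge0 //; apply: partial_normsq_lower.
Qed.

Lemma lower_l2_inv u : l2 (lower u) ->
  l2 u /\ l2norm u <= Num.sqrt (4 * D / y ^+ 2) * l2norm (lower u).
Proof.
have D0 : 0 <= D by apply: le_trans (p_le 0); apply: normsq_ge0.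
apply: l2_dominated => [|N]; first exact: sqrtr_ge0.
rewrite sqr_sqrtr; last by rewrite !mulr_ge0 ?invr_ge0 ?sqr_ge0.
exact: partial_normsq_lower_ge.
Qed.

End BidiagonalFactor.

(** * Similarity and resolvent sets *)

Local Notation shift A z := (simx_add A (simx_scalar (- z))).

(** Since [S] preserves and reflects l2, the intertwining relation matches the maximal domains of
    the two operators; bijectivity and the resolvent bound then transfer. The reverse inclusion
    comes from exchanging [S] and [T]. *)
Lemma resolvent_set_similar (A B : simx R) (S T : (nat -> R[i]) -> nat -> R[i])
    (C C' : R) :
  cancel S T -> cancel T S -> 0 <= C -> 0 <= C' ->
  (forall u, l2 u -> l2 (S u) /\ l2norm (S u) <= C * l2norm u) ->
  (forall u, l2 (S u) -> l2 u /\ l2norm u <= C' * l2norm (S u)) ->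
  (forall (z : R[i]) u,
    simx_app (shift A z) (S u) = S (simx_app (shift B z) u)) ->
  (resolvent_set A `<=` resolvent_set B)%classic.
Proof.
move=> ST TS C0 C'0 hS hT AB z [[Adom Ainj Asurj] [M hM]].
have domE u : dom (shift B z) u <-> dom (shift A z) (S u).
  split=> -[hu hzu]; split.
  - exact: (hS _ hu).1.
  - by rewrite AB; exact: (hS _ hzu).1.
  - exact: (hT _ hu).1.
  - by move: hzu; rewrite AB => /hT[].
split; first split.
- by move=> u [].
- move=> u v; rewrite !inE => /domE hu /domE hv e.
  by apply: (can_inj ST); apply: Ainj; rewrite ?inE // !AB e.
- move=> w hw; have [v hv e] := Asurj (S w) (hS w hw).1.
  exists (T v); first by apply/domE; rewrite TS.
  by apply: (can_inj ST); rewrite -AB TS.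
(* Chain [|u| <= C' |S u| <= C' M |S (B - z) u| <= C' M C |(B - z) u|]; the maximum with 0 covers a
   negative [M]. *)
- exists (C' * (Num.max M 0 * C)) => u hu.
  have [ul2 Bul2] := hu.
  have := hM _ ((domE u).1 hu); rewrite AB => h.
  apply: le_trans (hT _ (hS _ ul2).1).2 _.
  rewrite -!mulrA ler_wpM2l //; apply: le_trans h _.
  have leM : M <= Num.max M 0 by rewrite le_max lexx.
  apply: le_trans (ler_wpM2r (l2norm_ge0 _) leM) _.
  by rewrite ler_wpM2l ?le_max ?lexx ?orbT //; apply: (hS _ Bul2).2.
Qed.

End Sequences.

(** * Entries of a bounded operator *)

Section BoundedEntries.
Variable R : realType.
Implicit Types (A : simx R) (u : nat -> R[i]).

Definition unit_seq (j k : nat) : R[i] := (k == j)%:R.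

Lemma unit_seq_l2 j : l2 (unit_seq j) /\ l2norm (unit_seq j) <= 1.
Proof.
apply: l2_bounded => // N; rewrite expr1n.
suff -> : partial_normsq (unit_seq j) N = (j < N)%:R by rewrite lern1 leq_b1.
elim: N => [|N IH]; first by rewrite partial_normsq0.
rewrite partial_normsqS IH ltnS /unit_seq (leq_eqVlt j N) (eq_sym j).
have [->|_] := eqVneq N j; first
  by rewrite ltnn /normsq /= expr0n expr1n addr0 add0r.
by rewrite normsq0 addr0.
Qed.

(** [A i j] is a coordinate of the image of the [j]-th unit vector. The range [j < i.+2] is the one
    over which [simx_app] sums. *)
Lemma bounded_operator_entries A : bounded_operator A ->
  exists K : R, forall i j, (j < i.+2)%N -> normsq (A i j) <= K.
Proof.
move=> [domA [M hM]]; exists (Num.max M 0 ^+ 2) => i j ji.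
have [ej ej1] := unit_seq_l2 j.
have Aej : l2 (simx_app A (unit_seq j)).
  by have [] : dom A (unit_seq j) by rewrite domA.
have <- : simx_app A (unit_seq j) i = A i j.
  rewrite /simx_app (bigD1 (Ordinal ji)) //= /unit_seq eqxx mulr1.
  rewrite big1 ?addr0 // => k; rewrite -val_eqE /= => /negPf ->.
  by rewrite mulr0.
apply: le_trans (normsq_le_l2norm i Aej) _.
have [leM le0] : M <= Num.max M 0 /\ 0 <= Num.max M 0.
  by rewrite !le_max !lexx orbT.
rewrite ler_pXn2r ?nnegrE ?l2norm_ge0 //; apply: le_trans (hM _ ej) _.
by apply: le_trans (ler_wpM2r (l2norm_ge0 _) leM) _; rewrite ler_piMr.
Qed.

End BoundedEntries.

(** * Positivity of the recurrence coefficients *)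

Section OrthogonalPolynomials.
Variables (R : realType) (Lf : {scalar {poly R[i]}}).
Variables (P : nat -> {poly R[i]}) (c lam : nat -> R).
Hypothesis hLf : positive_definite Lf.
Hypothesis hP : monic_orthogonal Lf P.
Hypothesis hrec : recurrence_coefficients P c lam.

Lemma horner_recurrence n z : (P n.+2).[z] =
  (z - (c n.+2)%:C) * (P n.+1).[z] - (lam n.+2)%:C * (P n).[z].
Proof.
have [_ _ /(_ n.+1 isT) /(congr1 (horner^~ z))] := hrec.
rewrite !hornerE /= => e.
by rewrite mulrBl e; ring.
Qed.

Lemma horner_real n (x : R) : complex.Im (P n).[x%:C] = 0.
Proof.
have [P0 P1 _] := hrec.
suff: complex.Im (P n).[x%:C] = 0 /\ complex.Im (P n.+1).[x%:C] = 0 by case.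
elim: n => [|n [IH1 IH2]].
  by rewrite P0 P1 !hornerE /= subrr.
split=> //; rewrite horner_recurrence.
case: (P n).[_] (P n.+1).[_] IH1 IH2 => [a b] [a' b'] /= -> ->.
by ring.
Qed.

(** [P n] is real on the real line, so its square is non-negative there without any conjugation. *)
Lemma functional_sqr_gt0 n : 0 < Lf (P n * P n).
Proof.
have [monP _ _] := hP.
apply: hLf => [|x]; first by rewrite mulf_neq0 ?monic_neq0.
rewrite hornerM; case: (P n).[_] (horner_real n x) => a b /= ->.
by rewrite lecE /= !mulr0 !mul0r addr0 subr0 eqxx -expr2 sqr_ge0.
Qed.

(** Evaluate [Lf ('X * P n.+1 * P n)] twice, expanding ['X * P n.+1] and then ['X * P n]: [lam n.+2]
    is a quotient of two positive numbers. *)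
Lemma recurrence_lam_gt0 n : 0 < lam n.+2.
Proof.
have [_ _ orth] := hP; have [P0 P1 Prec] := hrec.
have e1 : Lf ('X * P n.+1 * P n) = (lam n.+2)%:C * Lf (P n * P n).
  rewrite Prec // !mulrDl -!scalerAl !linearD !linearZ /=
    (orth n.+2 n) ?(orth n.+1 n) ?mulr0 ?add0r //; lia.
have e2 : Lf ('X * P n.+1 * P n) = Lf (P n.+1 * P n.+1).
  (* The three-term recurrence starts at index 1; at index 0 the formula for [P 1] replaces it. *)
  rewrite mulrAC; case: n {e1} => [|n].
    have -> : 'X * P 0%N = P 1%N + (c 1)%:C *: P 0%N.
      by rewrite P0 P1 mulr1 -mul_polyC mulr1 subrK.
    by rewrite mulrDl -scalerAl linearD linearZ /= (orth 0 1)%N ?mulr0 ?addr0.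
  rewrite Prec // !mulrDl -!scalerAl !linearD !linearZ /=
    (orth n.+1 n.+2) ?(orth n n.+2) ?mulr0 ?addr0 //; lia.
have := functional_sqr_gt0 n.+1; rewrite -e2 e1.
case: (Lf _) (functional_sqr_gt0 n) => a b.
rewrite !ltcE /= => /andP[/eqP -> a0].
by rewrite !mulr0 subr0 => /andP[_]; rewrite pmulr_lgt0.
Qed.

(** * The ratios [d_j] at a non-real point *)

Section Christoffel.
Variable kappa : R[i].
Hypothesis hkappa : complex.Im kappa != 0.
Local Notation d := (christoffel_d P kappa).

Lemma christoffel_d0 : d 0 = (c 1)%:C - kappa.
Proof.
have [P0 P1 _] := hrec.
by rewrite /christoffel_d P0 P1 !hornerE divr1 opprB.
Qed.

Lemma christoffel_dS j : (P j).[kappa] != 0 -> (P j.+1).[kappa] != 0 ->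
  d j.+1 = (c j.+2)%:C - kappa - (lam j.+2)%:C / d j.
Proof.
move=> h0 h1; rewrite /christoffel_d horner_recurrence; field.
by rewrite h0 h1.
Qed.

(* [z |-> - lam / z] preserves the half plane where [Im z] has the sign of
   [- Im kappa], so adding [c - kappa] keeps [|Im d_j| >= |Im kappa|]. *)
Lemma Im_christoffel_d j : (P j).[kappa] != 0 /\
  complex.Im kappa * complex.Im (d j) <= - complex.Im kappa ^+ 2.
Proof.
(* A zero of [P k.+1] at [kappa] would give [d k = 0], contradicting the bound; thus each bound
   licenses the next division. *)
have dP k : complex.Im kappa * complex.Im (d k) <= - complex.Im kappa ^+ 2 ->
    (P k.+1).[kappa] != 0.
  apply: contraTneq => h; rewrite /christoffel_d h mul0r oppr0 mulr0.
  by rewrite -ltNge oppr_lt0 exprn_even_gt0.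
elim: j => [|j [h0 IH]].
  have [P0 _ _] := hrec.
  rewrite P0 hornerE oner_eq0 christoffel_d0; split=> //.
  by case: kappa => a b /=; rewrite expr2; lra.
have h1 := dP _ IH; split=> //; rewrite christoffel_dS //.
case: (d j) IH => a b; case: kappa => k1 k2 /= IH.
set n2 := a ^+ 2 + b ^+ 2.
have n2_ge0 : 0 <= n2 by rewrite addr_ge0 ?sqr_ge0.
have : k2 * b * (lam j.+2 / n2) <= 0.
  rewrite mulr_le0_ge0 ?divr_ge0 ?(ltW (recurrence_lam_gt0 _)) //.
  by apply: le_trans IH _; rewrite oppr_le0 sqr_ge0.
by rewrite expr2; nra.
Qed.

Lemma horner_neq0 j : (P j).[kappa] != 0.
Proof. exact: (Im_christoffel_d j).1. Qed.

Lemma normsq_christoffel_d_ge j : complex.Im kappa ^+ 2 <= normsq (d j).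
Proof.
have [_] := Im_christoffel_d j; case: (d j) => a b; rewrite /normsq /=.
move: (complex.Im kappa) => y h.
by have := sqr_ge0 (y + b); have := sqr_ge0 a; nra.
Qed.

Lemma christoffel_d_neq0 j : d j != 0.
Proof.
by rewrite /christoffel_d oppr_eq0 mulf_neq0 ?invr_eq0 ?horner_neq0.
Qed.

(** * The factorization of [J - kappa] and bounds on its factor *)

Variable s : nat -> R[i].
Hypothesis hs : is_sqrt_choice P kappa s.

Definition christoffel_sub j : R[i] := christoffel_v P lam kappa j * s j.
Local Notation q := christoffel_sub.

Lemma jacobi_off_sqr j : jacobi_off lam j ^+ 2 = lam j.+2.
Proof. by rewrite sqr_sqrtr // ltW // recurrence_lam_gt0. Qed.

Lemma christoffel_s_neq0 j : s j != 0.
Proof. by have := christoffel_d_neq0 j; rewrite -hs expf_eq0. Qed.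

Lemma christoffel_sub_sqr j : q j ^+ 2 = (lam j.+2)%:C / d j.
Proof.
rewrite /q /christoffel_v exprMn hs -jacobi_off_sqr rmorphXn /=.
by field; rewrite christoffel_d_neq0.
Qed.

Lemma LLT_off j : s j * q j = (jacobi_off lam j)%:C.
Proof.
rewrite /q /christoffel_v -hs; field.
by rewrite christoffel_s_neq0.
Qed.

Lemma LLT_diag0 : s 0%N ^+ 2 = (c 1)%:C - kappa.
Proof. by rewrite hs christoffel_d0. Qed.

Lemma LLT_diagS j : s j.+1 ^+ 2 + q j ^+ 2 = (c j.+2)%:C - kappa.
Proof.
by rewrite hs christoffel_sub_sqr christoffel_dS ?horner_neq0 // subrK.
Qed.

Lemma christoffel_factor_bounded (K : R) :
    (forall j, c j.+1 ^+ 2 <= K) -> (forall j, lam j.+2 <= K) ->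
  exists2 D : R, forall j, normsq (s j) <= D & forall j, normsq (q j) <= D.
Proof.
move=> hc hl; pose y2 := complex.Im kappa ^+ 2.
have y2_gt0 : 0 < y2 by rewrite exprn_even_gt0.
(* [F] bounds [|lam / d_j|^2] because [|d_j|^2 >= y2]; [E] bounds [|d_j|^2] by two uses of
   [normsqD_le] in the recursion for [d_j]. *)
pose F := K ^+ 2 / y2; pose E := 2 * (2 * (K + normsq kappa) + F).
have hF j : normsq ((lam j.+2)%:C / d j) <= F.
  rewrite normsqM normsqV ler_pM ?invr_ge0 ?normsq_ge0 //.
    rewrite /normsq /= expr0n addr0 ler_pXn2r ?nnegrE //.
      exact/ltW/recurrence_lam_gt0.
    exact: le_trans (sqr_ge0 _) (hc 0%N).
  rewrite lef_pV2 ?posrE ?normsq_christoffel_d_ge //.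
  exact: lt_le_trans (normsq_christoffel_d_ge j).
have hE0 j : normsq ((c j.+1)%:C - kappa) <= 2 * (K + normsq kappa).
  apply: le_trans (normsqD_le _ _) _; rewrite ler_wpM2l // lerD //.
    by rewrite /normsq /= expr0n addr0.
  by case: kappa => a b; rewrite /normsq /= !sqrrN.
have F_ge0 : 0 <= F by apply: le_trans (hF 0%N); exact: normsq_ge0.
have hE j : normsq (d j) <= E.
  case: j => [|j].
    rewrite christoffel_d0; have := hE0 0%N.
    have := normsq_ge0 ((c 1)%:C - kappa).
    by rewrite /E; lra.
  rewrite christoffel_dS ?horner_neq0 //; apply: le_trans (normsqD_le _ _) _.
  rewrite ler_wpM2l // lerD // -mulN1r normsqM.
  by rewrite {1}/normsq /= oppr0 expr0n addr0 sqrrN expr1n mul1r.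
have E_ge0 : 0 <= E by apply: le_trans (hE 0%N); exact: normsq_ge0.
(* From [t <= 1 + t^2] with [t = normsq z]; it passes from the squares [d_j] and [lam / d_j] to the
   entries of [L]. *)
have bound (z : R[i]) (B : R) : normsq (z ^+ 2) <= B -> normsq z <= 1 + B.
  by rewrite expr2 normsqM; nra.
exists (1 + E + F) => j.
  by have := hE j; rewrite -hs => /bound; lra.
by have := hF j; rewrite -christoffel_sub_sqr => /bound; lra.
Qed.

(** * Row-wise identities for [L L^T] and [L^T L] *)

Lemma jacobi_appE z (u : nat -> R[i]) :
  simx_app (simx_add (jacobi c lam) (simx_scalar (- z))) u =
  fun i => lower_app s q (upper_app s q u) i + (kappa - z) * u i.
Proof.
apply/funext => -[|i]; rewrite /simx_app /simx_add /simx_scalar /jacobi.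
  rewrite !big_ord_recr big_ord0 /= /lower_app /upper_app -LLT_off.
  have -> : (jacobi_diag c 0)%:C = s 0%N ^+ 2 + kappa
    by rewrite LLT_diag0 subrK.
  ring.
rewrite !big_ord_recr /= big1 => [|k _]; last first.
  have ki := ltn_ord k.
  rewrite !ifF ?addr0 ?mul0r //; apply/negbTE/eqP; lia.
rewrite !eqxx !ifF; try by apply/negbTE/eqP; lia.
rewrite /lower_app /upper_app -!LLT_off.
have -> : (jacobi_diag c i.+1)%:C = s i.+1 ^+ 2 + q i ^+ 2 + kappa.
  by rewrite LLT_diagS subrK.
ring.
Qed.

(** [L] is lower triangular, so any cut-off beyond [i] gives the full row. This freedom serves rows
    [i] and [i.+1], both summed over [k < i.+2] in [L^T L]. *)
Lemma christoffel_L_row i (u : nat -> R[i]) N : (i < N)%N ->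
  \sum_(k < N) christoffel_L P lam kappa s i k * u k = lower_app s q u i.
Proof.
move=> iN.
rewrite -(big_mkord xpredT
  (fun k => christoffel_L P lam kappa s i k * u k)).
rewrite (big_cat_nat (n := i.+1)) //= [X in _ + X]big1_seq => [|k]; last first.
  rewrite mem_index_iota => /andP[_ /andP[ik _]].
  rewrite /christoffel_L !ifF ?mul0r //;
    apply/negbTE/eqP; lia.
rewrite addr0 big_nat_recr //= /christoffel_L eqxx /lower_app addrC.
congr (_ + _).
case: i {iN} => [|i]; first by rewrite big_geq.
rewrite big_nat_recr //= big1_seq ?add0r => [|k]; last first.
  rewrite mem_index_iota => /andP[_ /andP[_ ik]].
  rewrite !ifF ?mul0r //; apply/negbTE/eqP; lia.
by rewrite eqxx ifF //; apply/negbTE/eqP; lia.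
Qed.

Lemma LTL_entry i k :
  let L := christoffel_L P lam kappa s in
  simx_mul (simx_tr L) L i k = s i * L i k + q i * L i.+1 k.
Proof.
rewrite /= /simx_mul /simx_tr !big_ord_recr /=.
rewrite big1 ?add0r => [|m _]; last first.
  have mi := ltn_ord m.
  by rewrite [X in X * _]/christoffel_L !ifF ?mul0r //; apply/negbTE/eqP; lia.
have -> : christoffel_L P lam kappa s i i = s i by rewrite /christoffel_L eqxx.
have -> // : christoffel_L P lam kappa s i.+1 i = q i.
by rewrite /christoffel_L eqxx ifF //; apply/negbTE/eqP; lia.
Qed.

Lemma christoffel_appE z (u : nat -> R[i]) :
  simx_app (simx_add (christoffel P lam kappa s) (simx_scalar (- z))) u =
  fun i => upper_app s q (lower_app s q u) i + (kappa - z) * u i.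
Proof.
apply/funext => i; rewrite /simx_app /christoffel /simx_add.
have distr (p r a b f g w : R[i]) :
  (p * a + r * b + f + g) * w = p * (a * w) + r * (b * w) + (f + g) * w by ring.
under eq_bigr => k _ do rewrite LTL_entry (distr (s i) (q i)).
rewrite !big_split /= -!mulr_sumr !christoffel_L_row //.
congr (_ + _).
rewrite !big_ord_recr /= big1 => [|k _]; last first.
  by rewrite /simx_scalar gtn_eqF ?ltn_ord // addr0 mul0r.
by rewrite /simx_scalar eqxx ltn_eqF // addr0 mul0r addr0 add0r.
Qed.

(** Both sides are [L L^T L u + (kappa - z) L u]; each row is a finite sum, so associativity holds
    for arbitrary sequences. *)
Lemma jacobi_christoffel_intertwine z (u : nat -> R[i]) :
  simx_app (simx_add (jacobi c lam) (simx_scalar (- z))) (lower_app s q u) =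
  lower_app s q
    (simx_app (simx_add (christoffel P lam kappa s) (simx_scalar (- z))) u).
Proof.
rewrite jacobi_appE christoffel_appE; apply/funext => -[|i];
  by rewrite /lower_app /=; ring.
Qed.

End Christoffel.
End OrthogonalPolynomials.

Theorem theorem5p5 (R : realType) (Lf : {scalar {poly R[i]}})
    (P : nat -> {poly R[i]}) (c lam : nat -> R)
    (hLf : positive_definite Lf) (hLf1 : Lf 1 = 1)
    (hP : monic_orthogonal Lf P)
    (hrec : recurrence_coefficients P c lam)
    (hJ : bounded_operator (jacobi c lam))
    (kappa : R[i]) (hkappa : complex.Im kappa != 0)
    (s : nat -> R[i]) (hs : is_sqrt_choice P kappa s) :
  spectrum (jacobi c lam) = spectrum (christoffel P lam kappa s).
Proof.
have [K hK] := bounded_operator_entries hJ.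
have hc j : c j.+1 ^+ 2 <= K.
  have := hK j j (leqnSn _).
  by rewrite /jacobi eqxx /normsq /= expr0n addr0.
have hl j : lam j.+2 <= K.
  have := hK j j.+1 (leqnn _).
  rewrite /jacobi ltn_eqF // eqxx /normsq /= expr0n addr0.
  by rewrite (jacobi_off_sqr hLf hP hrec).
have [D sD qD] := christoffel_factor_bounded hLf hP hrec hkappa hs hc hl.
pose q := christoffel_sub P lam kappa s.
have s_neq0 := christoffel_s_neq0 hLf hP hrec hkappa hs.
have LT : cancel (lower_app s q) (lower_solve s q).
  by move=> u; apply: lower_appK.
have TL : cancel (lower_solve s q) (lower_app s q).
  by move=> u; apply: lower_solveK.
have AB := jacobi_christoffel_intertwine hLf hP hrec hkappa hs.
have L_le u : l2 u -> l2 (lower_app s q u) /\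
    l2norm (lower_app s q u) <= Num.sqrt (4 * D) * l2norm u.
  exact: lower_l2.
have ImB (r : R) : complex.Im (r%:C - kappa) = - complex.Im kappa.
  by case: (kappa) => a b /=; rewrite add0r.
have L_ge u : l2 (lower_app s q u) -> l2 u /\ l2norm u <=
    Num.sqrt (4 * D / complex.Im kappa ^+ 2) * l2norm (lower_app s q u).
  apply: (lower_l2_inv s_neq0 sD qD _ _ _ hkappa).
  - by rewrite (LLT_diag0 hrec hs).
  - by move=> j; rewrite (LLT_diagS hLf hP hrec hkappa hs).
  - by move=> j; rewrite (LLT_off hLf hP hrec hkappa hs).
rewrite /spectrum; congr (~` _)%classic; apply/seteqP; split.
- exact: (resolvent_set_similar LT TL (sqrtr_ge0 _) (sqrtr_ge0 _) L_le L_ge AB).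
(* Same lemma for the inverse of [L]: the upper and lower bounds on [L] exchange roles, and [AB] is
   conjugated by the inverse. *)
- apply: (resolvent_set_similar TL LT (sqrtr_ge0 _) (sqrtr_ge0 _)) =>
    [u hu|u hu|z u].
  + by have := L_ge (lower_solve s q u); rewrite TL; apply.
  + by have := L_le _ hu; rewrite TL; apply.
  + by apply: (can_inj LT); rewrite TL -[LHS]AB TL.
Qed.
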